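(* Let $d\in\mathbb{N}$. For all $\alpha\in(d,d+1)$ and all integers $k\ge d+2$, there exist $A_{\alpha,k},B_{\alpha,k}>0$ and $N_{\alpha,k}\in\mathbb{N}$ such that for all integers $N\ge N_{\alpha,k}$, $$A_{\alpha,k}N^{2-\alpha/(d+1)}\le\#\{P\subset[1,N]\cap\mathbb{Z} : P\in\mathcal{P}_{k,1},\ (\lfloor n^\alpha\rfloor)_{n\in P}\in\mathcal{P}_{k,d}\}\le B_{\alpha,k}N^{2-\alpha/(d+1)}.$$
   Context: $\mathbb{N}=\{1,2,\ldots\}$; $\lfloor x\rfloor$ is the greatest integer $\le x$. For integers $d\ge1$ and $k\ge d+2$, $\mathcal{P}_{k,d}$ is the set of all strictly increasing sequences $(a(n))_{n=0}^{k-1}$ of elements of $\mathbb{N}$ such that $(\Delta_1^d a(n))_{n=0}^{k-d-1}$ is a constant sequence, where $\Delta_1 a(n)=a(n+1)-a(n)$ and $\Delta_1^m=\Delta_1\circ\Delta_1^{m-1}$ for $m\ge2$. Equivalently, $a(n)=p(n)$ for $0\le n<k$ for some polynomial $p\in\mathbb{Q}[x]$ of degree at most $d$. In particular $\mathcal{P}_{k,1}$ is the set of arithmetic progressions of length $k$ in $\mathbb{N}$. A subset of $\mathbb{N}$ is identified with the strictly increasing sequence of its elements; $(\lfloor n^\alpha\rfloor)_{n\in P}$ is indexed by the elements of $P$ in increasing order. *)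

(* Defs.v *)
From mathcomp Require Export all_boot all_order all_algebra.
From mathcomp Require Export reals exp.

Set Implicit Arguments.
Unset Strict Implicit.
Unset Printing Implicit Defensive.

Import Order.TTheory GRing.Theory Num.Theory.

Local Open Scope ring_scope.

Definition diff (a : seq int) : seq int :=
  mkseq (fun n => a`_n.+1 - a`_n) (size a).-1.

(* The class P_{k,d}, with positive integers taken in int so that iterated
   differences are not truncated; iter d diff a has size k - d. *)
Definition in_P (k d : nat) (a : seq int) : bool :=
  [&& size a == k, all (fun x => 0 < x) a, sorted <%R a
    & constant (iter d diff a)].

(* A subset P of {0, ..., N} as the sequence of its elements: enum lists
   ordinals in increasing order. *)
Definition elements (N : nat) (P : {set 'I_N.+1}) : seq nat :=
  [seq nat_of_ord i | i <- enum P].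

Definition floor_pow (R : realType) (alpha : R) (n : nat) : int :=
  Num.floor (powR n%:R alpha).

Definition AP_to_P (R : realType) (alpha : R) (k d N : nat) :
    {set {set 'I_N.+1}} :=
  [set P : {set 'I_N.+1} |
    [&& P \subset [set i : 'I_N.+1 | (1 <= i)%N],
        in_P k 1 [seq n%:Z | n <- elements P]
      & in_P k d [seq floor_pow alpha n | n <- elements P]]].

(* Main.v *)
Require Import Defs.
From mathcomp Require Import all_boot all_order all_algebra.
From mathcomp Require Import reals exp.
From mathcomp Require Import topology normedtype derive realfun.
From mathcomp Require Import zify lra ring.

(** Write an arithmetic progression as n + j r with j < k.  Its image under
    x |-> [x^alpha] lies in P_(k,d) exactly when the (d + 1)-th differences of
    that image vanish, strict growth being automatic.  By the mean value theorem
    ([step_diff_powR]) the (d + 1)-th differences of the powers themselves are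
    c r^(d+1) y^(alpha-d-1) for some y between n and n + (k - 1) r, with
    c = alpha (alpha - 1) ... (alpha - d) > 0.  Let g = 1 - alpha/(d + 1), so
    that N first terms and N^g steps make N^(2 - alpha/(d+1)) progressions.

    Upper bound.  When the differences of the integer parts vanish, those of the
    powers equal those of the fractional parts, hence are at most 2^(d+1).  As
    y <= N this forces r = O(N^g) ([step_le]), and there are at most N choices
    for n ([card_AP_to_P_le]).

    Lower bound.  Colour n by the interval of length 2^-(d+2) in which the
    fractional part of n^alpha lies.  On a progression of a single colour the
    (d + 1)-th differences of the fractional parts are at most 1/2; if moreover n is of order N and r is at most a small
    multiple of N^g, those of the powers are below 1/2, so that those of the
    integer parts are integers of absolute value below 1, that is 0
    ([mono_diff_floor_eq0]).  Van der Waerden's theorem ([van_der_Waerden])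
    finds a monochromatic progression of k terms in every progression of W
    terms, where W depends on k and d only.  There are of the order of N^(1+g)
    progressions of W terms in range, and each progression of k terms arises
    from at most W^2 of them ([card_AP_to_P_ge]). *)

Set Implicit Arguments.
Unset Strict Implicit.
Unset Printing Implicit Defensive.

Import Order.TTheory GRing.Theory Num.Theory.
Import numFieldNormedType.Exports.

Local Open Scope ring_scope.

(** * Van der Waerden's theorem *)

(** The progression a, a + t, ..., a + k t has k + 1 terms.  Asking for one more
    step below W is what lets the next step of the induction use that extra
    term as a focus without enlarging the window. *)
Definition mono_AP (T : finType) (c : nat -> T) (k W : nat) : Prop :=
  exists a t y, [/\ (0 < t)%N, (a + k.+1 * t < W)%N &
    forall j, (j <= k)%N -> c (a + j * t)%N = y].

Definition focused (T : finType) (c : nat -> T) (k f : nat) (ys : seq T) :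
    Prop :=
  forall y, y \in ys -> exists a t, [/\ (0 < t)%N, (a + k.+1 * t)%N = f &
    forall j, (j <= k)%N -> c (a + j * t)%N = y].

Definition vdW_at (k : nat) : Prop :=
  forall T : finType, exists W, forall c : nat -> T, mono_AP c k W.

(** Colour focusing.  Colour each x by the pattern of c on [x, x + W): the
    case of k + 1 terms gives x and t such that the windows at x, x + t, ...,
    x + k t all carry the same pattern.  Raising the common difference of the
    progressions focused at f inside the window by t focuses them at
    x + (k + 1) t + f, and so does the progression x + f + j t, whose colour is
    that of the focus of the first window.  That colour is either new, or it
    prolongs one of the old progressions by one term. *)
Lemma vdW_focusing (k : nat) (T : finType) (s : nat) : vdW_at k ->
  exists W, forall c : nat -> T,
    (exists a t y, [/\ (0 < t)%N, (a + k.+1 * t < W)%N &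
       forall j, (j <= k.+1)%N -> c (a + j * t)%N = y]) \/
    (exists f ys, [/\ (f < W)%N, size ys = s, uniq ys & focused c k f ys]).
Proof.
move=> vdWk; elim: s => [|s [W IHs]].
  exists 1%N => c; right; exists 0%N, [::]; split=> // y.
have [W' HW'] := vdWk {ffun 'I_W -> T}.
exists (W' + W)%N => c.
have [x [t [w [t_gt0 ltxW' cw]]]] :=
  HW' (fun x => [ffun i : 'I_W => c (x + i)%N]).
have shift j i : (j <= k)%N -> (i < W)%N -> c (x + j * t + i)%N = c (x + i)%N.
  move=> lejk ltiW.
  have /ffunP/(_ (Ordinal ltiW)) := etrans (cw j lejk) (esym (cw 0%N (leq0n k))).
  by rewrite !ffunE mul0n addn0.
have [[a [q [y [q_gt0 ltaW Ha]]]]|[f [ys [ltfW sz_ys uniq_ys foc]]]] :=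
    IHs (fun i => c (x + i)%N).
  left; exists (x + a)%N, q, y; split=> // [|j lejk]; first by lia.
  by rewrite -addnA Ha.
have [in_ys|notin_ys] := boolP (c (x + f)%N \in ys).
  (* the focus prolongs the progression of its colour *)
  left; have [a [q [q_gt0 Ef Hq]]] := foc _ in_ys.
  exists (x + a)%N, q, (c (x + f)%N); split=> // [|j].
    by rewrite -addnA Ef; lia.
  rewrite leq_eqVlt => /orP[/eqP->|ltjk]; first by rewrite -addnA Ef.
  by rewrite -addnA Hq.
right; exists (x + k.+1 * t + f)%N, (c (x + f)%N :: ys); split=> //=.
- by lia.
- by rewrite sz_ys.
- by rewrite notin_ys.
move=> y; rewrite inE => /predU1P[->|/foc[a [q [q_gt0 Ef Hq]]]].
  exists (x + f)%N, t; split=> // [|j lejk]; first by lia.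
  by rewrite addnAC shift.
exists (x + a)%N, (t + q)%N; split=> // [||j lejk].
- by lia.
- by rewrite -Ef; lia.
rewrite mulnDr addnACA shift ?Hq //.
by apply: leq_ltn_trans ltfW; rewrite -Ef leq_add2l leq_mul2r (leq_trans lejk) ?orbT.
Qed.

(** Progressions of pairwise distinct colours cannot outnumber the colours, so
    asking for one more of them forces the other alternative.  The window is
    doubled because the new progression needs room for its own next step. *)
Lemma van_der_Waerden (k : nat) : vdW_at k.
Proof.
elim: k => [|k IHk] T.
  exists 2%N => c; exists 0%N, 1%N, (c 0%N); split=> // j.
  by rewrite leqn0 => /eqP->.
have [W HW] := vdW_focusing T #|T|.+1 IHk.
exists (W + W)%N => c.
have [[a [t [y [t_gt0 ltaW Ha]]]]|[f [ys [_ sz_ys /card_uniqP uniq_ys _]]]] := HW c.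
  by exists a, t, y; split=> //; nia.
by have := max_card [in ys]; rewrite uniq_ys sz_ys ltnn.
Qed.

(** * Finite differences *)

Definition fdiff (V : zmodType) (u : nat -> V) (n : nat) : V := u n.+1 - u n.

Definition step_diff (R : realType) (r : R) (g : R -> R) (x : R) : R :=
  g (x + r) - g x.

Lemma iter_fdiffS (V : zmodType) m (u : nat -> V) n :
  iter m.+1 (@fdiff V) u n = iter m (@fdiff V) u n.+1 - iter m (@fdiff V) u n.
Proof. by []. Qed.

Lemma iter_fdiffB (V : zmodType) m (u v : nat -> V) n :
  iter m (@fdiff V) (fun i => u i - v i) n =
    iter m (@fdiff V) u n - iter m (@fdiff V) v n.
Proof.
elim: m n => // m IHm n; rewrite !iter_fdiffS !IHm.
by rewrite !opprD !opprK addrACA.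
Qed.

Lemma iter_fdiff_local (V : zmodType) m (u v : nat -> V) n :
  (forall i, (n <= i <= n + m)%N -> u i = v i) ->
  iter m (@fdiff V) u n = iter m (@fdiff V) v n.
Proof.
elim: m n => [|m IHm] n uv; first by apply: uv; rewrite addn0 leqnn.
by rewrite !iter_fdiffS !IHm // => i ?; apply: uv; lia.
Qed.

Lemma iter_fdiff_cst (V : zmodType) m (y : V) n :
  iter m.+1 (@fdiff V) (fun=> y) n = 0.
Proof.
elim: m n => [|m IHm] n; first by rewrite /= /fdiff subrr.
by rewrite iter_fdiffS !IHm subrr.
Qed.

Lemma norm_iter_fdiff (R : realType) m (u : nat -> R) (b : R) n :
  (forall i, (n <= i <= n + m)%N -> `|u i| <= b) ->
  `|iter m (@fdiff R) u n| <= 2 ^+ m * b.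
Proof.
elim: m n => [|m IHm] n ub; first by rewrite expr0 mul1r ub // addn0 leqnn.
rewrite iter_fdiffS (le_trans (ler_normB _ _)) // exprS -mulrA mulr2n mulrDl mul1r.
by apply: lerD; apply: IHm => i ?; apply: ub; lia.
Qed.

Lemma iter_fdiff_AP (R : realType) m (g : R -> R) (x r : R) j :
  iter m (@fdiff R) (fun i => g (x + i%:R * r)) j =
    iter m (step_diff r) g (x + j%:R * r).
Proof.
elim: m j => // m IHm j; rewrite iter_fdiffS !IHm /= /step_diff.
by rewrite -natr1 mulrDl mul1r addrA.
Qed.

Lemma is_derive_iter_step_diff (R : realType) m (r : R) (g dg : R -> R) :
  0 <= r ->
  (forall x : R, 0 < x -> is_derive x 1 g (dg x)) ->
  forall x : R, 0 < x ->
    is_derive x 1 (iter m (step_diff r) g) (iter m (step_diff r) dg x).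
Proof.
move=> r0 Dg; elim: m => [|m IHm] x x0 /=; first exact: Dg.
have x'0 : 0 < x + r by rewrite ltr_wpDr.
have D1 := IHm _ x0; have D2 := IHm _ x'0.
apply: is_deriveB => //.
have Ds : is_derive x 1 (fun y : R => y + r) 1.
  by apply: is_derive_eq; rewrite addr0.
have := @is_derive1_comp _ _ (fun y : R => y + r) x _ _ D2 Ds.
by rewrite mulr1.
Qed.

(** An m-th difference of step r is r^m times an m-th derivative at an
    intermediate point.  Each application of the mean value theorem trades one
    difference for one derivative, and differences commute with derivation; the
    exponent has to vary in the induction since it drops by one each time. *)
Lemma step_diff_powR (R : realType) m (a r x : R) : 0 < r -> 0 < x ->
  exists2 y, x <= y <= x + m%:R * r &
    iter m (step_diff r) (fun y => powR y a) x =
      (\prod_(i < m) (a - i%:R)) * r ^+ m * powR y (a - m%:R).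
Proof.
move=> r_gt0; elim: m a x => [|m IHm] a x x_gt0.
  exists x; first by rewrite mul0r addr0 lexx.
  by rewrite big_ord0 mul1r expr0 mul1r subr0.
have H (y : R) : 0 < y -> is_derive y 1 (iter m (step_diff r) (fun y => powR y a))
     (iter m (step_diff r) (fun y => a * powR y (a - 1)) y).
  by apply: is_derive_iter_step_diff (ltW r_gt0) _ _ => z z_gt0.
have hx (y : R) : y \in `[x, x + r]%R -> 0 < y.
  by rewrite in_itv /= => /andP[/(lt_le_trans x_gt0)].
have ltxr : x < x + r by rewrite ltrDl.
have [||z zx Ez] := MVT ltxr (f := iter m (step_diff r) (fun y => powR y a))
   (df := iter m (step_diff r) (fun y => a * powR y (a - 1))).
- by move=> y yx; apply: H; apply: hx; apply: subset_itv_oo_cc.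
- apply: derivable_within_continuous => y yx.
  by have [] := H y (hx _ yx).
have z_gt0 : 0 < z by apply: hx; apply: subset_itv_oo_cc.
have scal y : iter m (step_diff r) (fun y => a * powR y (a - 1)) y
   = a * iter m (step_diff r) (fun y => powR y (a - 1)) y.
  by elim: m {IHm H Ez} y => // m IHm y; rewrite !iterS /step_diff !IHm mulrBr.
have [y yz Ey] := IHm (a - 1) z z_gt0.
exists y.
  move: zx yz; rewrite in_itv /= -natr1 mulrDl mul1r => /andP[? ?] /andP[? ?].
  by apply/andP; split; lra.
rewrite iterS {1}/step_diff Ez scal Ey (addrC x) addrK big_ord_recl subr0 exprSr.
have -> : a - 1 - m%:R = a - m.+1%:R by rewrite -addrA -opprD nat1r.
have -> : \prod_(i < m) (a - 1 - i%:R) = \prod_(i < m) (a - (lift ord0 i)%:R).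
  by apply: eq_bigr => i _; rewrite -addrA -opprD nat1r.
by rewrite -!mulrA; congr (_ * (_ * (_ * _))); rewrite mulrC.
Qed.

(** * Differences of integer parts *)

Section Floors.
Variable R : realType.
Implicit Types u : nat -> R.

Lemma iter_fdiff_intr m (u : nat -> int) n :
  (iter m (@fdiff int) u n)%:~R = iter m (@fdiff R) (fun i => (u i)%:~R) n :> R.
Proof. by elim: m n => // m IHm n; rewrite !iter_fdiffS intrB !IHm. Qed.

(** The differences of u are then those of its fractional parts, which are at
    most 1 in absolute value. *)
Lemma norm_diff_floor_eq0 m u n :
  iter m (@fdiff int) (fun i => Num.floor (u i)) n = 0 ->
  `|iter m (@fdiff R) u n| <= 2 ^+ m.
Proof.
move/(congr1 (fun z : int => z%:~R : R)); rewrite iter_fdiff_intr => E.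
have := iter_fdiffB m u (fun i => (Num.floor (u i))%:~R) n.
rewrite E subr0 => <-; rewrite -[leRHS]mulr1; apply: norm_iter_fdiff => i _.
have /andP[] := floor_itv (u i); rewrite intrD => fl1 fl2.
by rewrite ler_norml; apply/andP; split; lra.
Qed.

(** The key to the lower bound.  The difference of the integer parts is an
    integer; it is the small difference of u minus that of the fractional parts,
    and the latter is at most 1/2 as the fractional parts stay in an interval
    of length 2^-(m + 2).  An integer of absolute value below 1 is 0. *)
Lemma diff_floor_eq0 m u n (y : R) :
  `|iter m.+1 (@fdiff R) u n| < 2^-1 ->
  (forall i, (n <= i <= n + m.+1)%N ->
     y <= u i - (Num.floor (u i))%:~R <= y + (2 ^+ m.+2)^-1) ->
  iter m.+1 (@fdiff int) (fun i => Num.floor (u i)) n = 0.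
Proof.
move=> small_u near_y.
pose e i := u i - (Num.floor (u i))%:~R - y.
have e_small : `|iter m.+1 (@fdiff R) e n| <= 2^-1.
  have -> : 2^-1 = 2 ^+ m.+1 * (2 ^+ m.+2)^-1 :> R.
    by rewrite [2 ^+ m.+2]exprSr invfM mulVKf // expf_neq0 // pnatr_eq0.
  apply: norm_iter_fdiff => i /near_y/andP[ge_y le_y].
  by rewrite ger0_norm /e ?subr_ge0 // lerBlDl.
have := iter_fdiff_intr m.+1 (fun i => Num.floor (u i)) n.
rewrite (iter_fdiff_local (v := fun i => (u i - e i) - y)); last first.
  by move=> i _; rewrite /e !opprB; ring.
rewrite iter_fdiffB iter_fdiff_cst subr0 iter_fdiffB => E.
apply/eqP; rewrite -absz_eq0 -leqn0 -ltnS -ltz_nat.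
move/(congr1 Num.norm): E; rewrite -intr_norm => E.
rewrite abszE -(ltr_int R) E (le_lt_trans (ler_normB _ _)) //.
by rewrite (_ : 1%:~R = 2^-1 + 2^-1) ?ltr_leD //; field.
Qed.

End Floors.

(** * Progressions as finite sets *)

Lemma iter_diff_mkseq m (u : nat -> int) k :
  iter m Defs.diff (mkseq u k) = mkseq (iter m (@fdiff int) u) (k - m).
Proof.
elim: m => [|m IHm]; first by rewrite subn0.
rewrite iterS IHm /Defs.diff size_mkseq subnS; apply/eq_in_map => n.
by rewrite mem_iota => /andP[_ ltn]; rewrite !nth_mkseq //; lia.
Qed.

Lemma constant_mkseqP (u : nat -> int) n :
  reflect (forall j, (j.+1 < n)%N -> u j.+1 = u j) (constant (mkseq u n)).
Proof.
apply: (iffP (constantP 0 _)) => [[x]|H].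
  rewrite size_mkseq => E j ltj.
  have := congr1 (nth 0 ^~ j) E; have := congr1 (nth 0 ^~ j.+1) E.
  rewrite /= !nth_mkseq ?(ltnW ltj) // !nth_nseq ltj (ltnW ltj).
  by move=> -> ->.
exists (u 0%N); rewrite size_mkseq; apply: (@eq_from_nth _ 0).
  by rewrite size_mkseq size_nseq.
move=> i; rewrite size_mkseq => lti; rewrite nth_nseq lti nth_mkseq //.
by elim: i lti => // i IHi lti; rewrite H // IHi // ltnW.
Qed.

(** Constant d-th differences are vanishing (d + 1)-th ones, a form that can be
    used at single indices. *)
Lemma in_P_mkseqP k d (u : nat -> int) :
  reflect [/\ forall j, (j < k)%N -> 0 < u j,
              forall j, (j.+1 < k)%N -> u j < u j.+1
            & forall j, (j + d.+1 < k)%N -> iter d.+1 (@fdiff int) u j = 0]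
          (in_P k d (mkseq u k)).
Proof.
rewrite /in_P size_mkseq eqxx iter_diff_mkseq /=.
apply: (iffP and3P) => -[pos_u inc_u cst_u]; split.
- by move=> j ltj; move/allP: pos_u; apply; apply: map_f; rewrite mem_iota.
- move=> j ltj; move/(sortedP 0)/(_ j): inc_u; rewrite size_mkseq => /(_ ltj).
  by rewrite !nth_mkseq // ltnW.
- move=> j ltj; apply/eqP; rewrite subr_eq0; apply/eqP.
  by move/constant_mkseqP: cst_u; apply; lia.
- by apply/allP => _ /mapP[j + ->]; rewrite mem_iota => /andP[_]; apply: pos_u.
- apply/(sortedP 0) => j; rewrite size_mkseq => ltj.
  by rewrite !nth_mkseq ?(ltnW ltj) // inc_u.
- apply/constant_mkseqP => j ltj; apply/eqP; rewrite -subr_eq0; apply/eqP.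
  by apply: cst_u; lia.
Qed.

Definition APseq (n r k : nat) : seq nat := mkseq (fun j => n + j * r)%N k.

Lemma elements_sorted N (P : {set 'I_N.+1}) : sorted ltn (elements P).
Proof.
have -> : elements P = [seq i <- iota 0 N.+1 | i \in elements P].
  rewrite -val_enum_ord filter_map /elements enumT /enum_mem; congr map.
  apply/eq_filter => i /=.
  by rewrite (mem_map (@ord_inj N.+1)) mem_filter mem_index_enum andbT.
by apply: sorted_filter (iota_ltn_sorted _ _); apply: ltn_trans.
Qed.

Lemma elements_inj N : injective (@elements N).
Proof.
move=> P Q E; apply/setP => i.
rewrite -[i \in P]mem_enum -[i \in Q]mem_enum.
by rewrite -!(mem_map (@ord_inj N.+1)) -/(elements P) E.
Qed.

Lemma APset_exists N n r k : (0 < r)%N -> (n + k.-1 * r <= N)%N ->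
  exists P : {set 'I_N.+1}, elements P = APseq n r k.
Proof.
move=> r_gt0 leN; exists [set i : 'I_N.+1 | nat_of_ord i \in APseq n r k].
apply: (irr_sorted_eq ltn_trans ltnn (elements_sorted _)).
  apply/(sortedP 0%N) => j; rewrite size_mkseq => ltj.
  by rewrite !nth_mkseq ?(ltnW ltj) // ltn_add2l ltn_mul2r r_gt0 ltnSn.
move=> x; apply/mapP/idP => [[i + ->]|Hx]; first by rewrite mem_enum inE.
have ltx : (x < N.+1)%N.
  move/mapP: Hx => [j + ->]; rewrite mem_iota => /andP[_ ltj]; nia.
by exists (Ordinal ltx); rewrite ?mem_enum ?inE.
Qed.

Lemma APseq_inj k n r n' r' :
  (1 < k)%N -> APseq n r k = APseq n' r' k -> n = n' /\ r = r'.
Proof.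
move=> lt1k E.
have := congr1 (nth 0%N ^~ 0%N) E; have := congr1 (nth 0%N ^~ 1%N) E.
by rewrite /= !nth_mkseq ?(ltnW lt1k) //; lia.
Qed.

Section Members.

Variables (R : realType) (alpha : R) (k d N : nat).

(** Vanishing second differences make the elements of P a progression
    [n + j * r], since k > 2 leaves at least one such difference. *)
Lemma AP_to_P_elim (P : {set 'I_N.+1}) : (2 < k)%N -> P \in AP_to_P alpha k d N ->
  exists n r, [/\ (0 < n)%N, (0 < r)%N, (n + k.-1 * r <= N)%N,
      elements P = APseq n r k
    & forall j, (j + d.+1 < k)%N ->
        iter d.+1 (@fdiff int) (fun j => floor_pow alpha (n + j * r)) j = 0].
Proof.
move=> lt2k; rewrite inE => /and3P[_ AP_P].
have szP : size (elements P) = k by case/and4P: AP_P; rewrite size_map => /eqP.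
set v := nth 0%N (elements P).
have Ev : elements P = mkseq v k by rewrite -szP mkseq_nth.
move: AP_P; rewrite Ev -!map_comp -![map _ (iota 0 k)]/(mkseq _ k).
move=> /in_P_mkseqP[pos_v inc_v cst_v] /in_P_mkseqP[_ _ cst_fl].
have v0 : (0 < v 0)%N by apply: (pos_v 0%N); lia.
have v1 : (v 0 < v 1)%N by apply: (inc_v 0%N); lia.
have vE j : (j < k)%N -> v j = (v 0 + j * (v 1 - v 0))%N.
  have [m] := ubnP j; elim: m j => // m IHm [|[|j]] ltm ltj; try lia.
  have := IHm j.+1 _ (ltnW ltj); have := IHm j _ (ltnW (ltnW ltj)).
  have := cst_v j; rewrite /= /fdiff /=; lia.
exists (v 0), (v 1 - v 0)%N; split=> //.
- by rewrite subn_gt0.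
- rewrite -vE; last by lia.
  have : v k.-1 \in elements P by rewrite mem_nth // szP; lia.
  by case/mapP => i _ ->; rewrite -ltnS.
- by apply/eq_in_map => j; rewrite mem_iota => /andP[_ /vE].
- move=> j ltj; rewrite -[RHS](cst_fl j ltj); apply: iter_fdiff_local => i Hi /=.
  by rewrite -vE //; lia.
Qed.

Hypothesis alpha_ge1 : 1 <= alpha.

Lemma floor_pow_gt0 n : (0 < n)%N -> 0 < floor_pow alpha n.
Proof.
move=> n_gt0; rewrite floor_gt0; have n_ge1 : 1 <= n%:R :> R by rewrite ler1n.
exact: le_trans n_ge1 (le1r_powR n_ge1 alpha_ge1).
Qed.

(** As alpha >= 1, consecutive powers are at least 1 apart, so that taking
    integer parts keeps them distinct. *)
Lemma floor_pow_lt m n : (0 < m)%N -> (m < n)%N ->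
  floor_pow alpha m < floor_pow alpha n.
Proof.
move=> m_gt0 ltmn.
have m_ge1 : 1 <= m%:R :> R by rewrite ler1n.
have a_gt0 : 0 < alpha by apply: lt_le_trans alpha_ge1.
suff gap : powR m%:R alpha + 1 <= powR n%:R alpha.
  rewrite -lezD1 floor_ge_int intrD (le_trans _ gap) // lerD2r.
  exact: floor_le.
rewrite -!(mulr_powRB1 (ler0n _ _) a_gt0).
have ge1 : 1 <= powR m%:R (alpha - 1).
  have a1_ge0 : 0 <= alpha - 1 by rewrite subr_ge0.
  by rewrite (le_trans _ (ler_powR m_ge1 a1_ge0)) // powRr0.
have le_mn : powR m%:R (alpha - 1) <= powR n%:R (alpha - 1).
  by apply: ge0_ler_powR; rewrite ?nnegrE ?ler0n ?subr_ge0 ?ler_nat // ltnW.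
have : m.+1%:R <= n%:R :> R by rewrite ler_nat.
rewrite -natr1; move: (powR m%:R _) (powR n%:R _) ge1 le_mn => x y; nra.
Qed.

Lemma AP_to_P_intro (P : {set 'I_N.+1}) n r : (0 < n)%N -> (0 < r)%N ->
  elements P = APseq n r k ->
  (forall j, (j + d.+1 < k)%N ->
     iter d.+1 (@fdiff int) (fun j => floor_pow alpha (n + j * r)) j = 0) ->
  P \in AP_to_P alpha k d N.
Proof.
move=> n_gt0 r_gt0 EP cst_fl; rewrite inE EP -!map_comp.
rewrite -![map _ (iota 0 k)]/(mkseq _ k); apply/and3P; split.
- apply/subsetP => i iP; rewrite inE.
  have : nat_of_ord i \in elements P by apply: map_f; rewrite mem_enum.
  by rewrite EP => /mapP[j _ ->]; rewrite ltn_addr.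
- apply/in_P_mkseqP; split=> /= j _; rewrite /fdiff /=; nia.
- apply/in_P_mkseqP; split=> //= j ltj.
    by rewrite floor_pow_gt0 // ltn_addr.
  by rewrite floor_pow_lt ?ltn_add2l ?ltn_mul2r ?r_gt0 ?ltnSn // ltn_addr.
Qed.

End Members.

(** * Differences along the powers *)

Section Power.
Variables (R : realType) (d : nat) (alpha : R).
Hypothesis halpha : d%:R < alpha < d.+1%:R.

Definition falling : R := \prod_(i < d.+1) (alpha - i%:R).

(** The opposite of the exponent left after d + 1 derivations of x^alpha, so
    that all powers below have positive exponents. *)
Definition gap_exp : R := d.+1%:R - alpha.

(** The critical size of the step: if r = N^step_exp, then the (d + 1)-th
    differences r^(d + 1) N^(alpha - d - 1) are of order 1. *)
Definition step_exp : R := 1 - alpha / d.+1%:R.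

Lemma falling_gt0 : 0 < falling.
Proof.
case/andP: halpha => lt_da _; apply: prodr_gt0 => i _; rewrite subr_gt0.
by apply: le_lt_trans lt_da; rewrite ler_nat -ltnS.
Qed.

Lemma gap_exp_bounds : 0 < gap_exp < 1.
Proof.
move: halpha; rewrite /gap_exp -natr1 => /andP[? ?].
by apply/andP; split; lra.
Qed.

Lemma step_expE : step_exp * d.+1%:R = gap_exp.
Proof. by rewrite mulrBl mul1r divfK ?pnatr_eq0. Qed.

Lemma step_exp_bounds : 0 < step_exp < 1.
Proof.
have D_gt0 : 0 < d.+1%:R :> R by rewrite ltr0n.
have a_gt0 : 0 < alpha by case/andP: halpha => + _; apply: le_lt_trans.
case/andP: halpha => _ lt_aD.
by rewrite subr_gt0 ltr_pdivrMr // mul1r lt_aD ltrBlDr ltrDl divr_gt0.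
Qed.

Lemma powR_step_exp (x : R) : powR x step_exp ^+ d.+1 = powR x gap_exp.
Proof. by rewrite -powR_mulrn ?powR_ge0 // -powRrM step_expE. Qed.

Lemma diff_powR n r j : (0 < n)%N -> (0 < r)%N ->
  exists2 y, (n + j * r)%:R <= y <= (n + (j + d.+1) * r)%:R &
    iter d.+1 (@fdiff R) (fun i => powR (n + i * r)%:R alpha) j
      = falling * r%:R ^+ d.+1 / powR y gap_exp.
Proof.
move=> n_gt0 r_gt0.
have r_gt0' : 0 < r%:R :> R by rewrite ltr0n.
have x_gt0 : 0 < n%:R + j%:R * r%:R :> R.
  by rewrite -natrM -natrD ltr0n ltn_addr.
have [y Hy Ey] := step_diff_powR d.+1 alpha r_gt0' x_gt0.
exists y.
  by rewrite mulnDl addnA ![(n + j * r)%:R]natrD natrD [(n + _)%:R]natrD !natrM.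
rewrite -powRN opprB -Ey -iter_fdiff_AP; apply: iter_fdiff_local => i _.
by rewrite natrD natrM.
Qed.

(** For the upper bound: the difference of the powers is bounded as the integer
    parts have none, while the intermediate point is at most N. *)
Lemma step_le N n r : (0 < n)%N -> (0 < r)%N -> (n + d.+1 * r <= N)%N ->
  iter d.+1 (@fdiff int) (fun j => floor_pow alpha (n + j * r)) 0%N = 0 ->
  r%:R <= (1 + 2 ^+ d.+1 / falling) * powR N%:R step_exp.
Proof.
move=> n_gt0 r_gt0 leN /norm_diff_floor_eq0.
have [y /andP[le_ny le_yn] ->] := diff_powR 0 n_gt0 r_gt0.
have c_gt0 := falling_gt0; have /andP[e_gt0 e_lt1] := gap_exp_bounds.
have y_gt0 : 0 < y by apply: lt_le_trans le_ny; rewrite ltr0n ltn_addr.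
have ye_gt0 : 0 < powR y gap_exp by rewrite powR_gt0.
rewrite ger0_norm; last by rewrite !mulr_ge0 ?invr_ge0 ?exprn_ge0 // ltW.
rewrite ler_pdivrMr // -ler_pdivlMl // mulrA => le_rD.
have le_yN : powR y gap_exp <= powR N%:R gap_exp.
  apply: ge0_ler_powR; rewrite ?nnegrE ?ler0n ?(ltW y_gt0) ?(ltW e_gt0) //.
  by apply: le_trans le_yn _; rewrite ler_nat.
set K := 2 ^+ d.+1 / falling.
have K_ge0 : 0 <= K by rewrite divr_ge0 ?exprn_ge0 // ltW.
(* adding 1 makes the constant exceed its own root of order d + 1 *)
have K1_ge0 : 0 <= 1 + K by rewrite addr_ge0.
rewrite -(@ler_pXn2r _ d.+1) ?nnegrE ?mulr_ge0 ?powR_ge0 ?ler0n //.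
rewrite exprMn powR_step_exp (le_trans le_rD) // [falling^-1 * _]mulrC -/K.
apply: ler_pM; rewrite ?powR_ge0 //.
apply: le_trans (_ : 1 + K <= _); first by rewrite lerDr.
by rewrite ler_eXnr // lerDl.
Qed.

(** For the lower bound: the intermediate point is at least n, hence at least
    N / 4. *)
Lemma diff_small N n r j (rho : R) : (0 < n)%N -> (0 < r)%N -> (N <= 4 * n)%N ->
  0 < rho <= 1 -> 8 * falling * rho < 1 -> r%:R <= rho * powR N%:R step_exp ->
  `|iter d.+1 (@fdiff R) (fun i => powR (n + i * r)%:R alpha) j| < 2^-1.
Proof.
move=> n_gt0 r_gt0 leN /andP[rho_gt0 rho_le1] crho le_r.
have [y /andP[le_ny le_yn] ->] := diff_powR j n_gt0 r_gt0.
have c_gt0 := falling_gt0; have /andP[e_gt0 e_lt1] := gap_exp_bounds.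
have y_gt0 : 0 < y by apply: lt_le_trans le_ny; rewrite ltr0n ltn_addr.
have ye_gt0 : 0 < powR y gap_exp by rewrite powR_gt0.
rewrite ger0_norm; last by rewrite !mulr_ge0 ?invr_ge0 ?exprn_ge0 // ltW.
have le_Ny : powR N%:R gap_exp <= 4 * powR y gap_exp.
  apply: le_trans (_ : powR (4 * y) gap_exp <= _).
    apply: ge0_ler_powR;
      rewrite ?nnegrE ?ler0n ?(ltW e_gt0) ?mulr_ge0 ?(ltW y_gt0) //.
    apply: le_trans (_ : (4 * n)%:R <= _); first by rewrite ler_nat.
    rewrite natrM ler_pM2l // (le_trans _ le_ny) // ler_nat leq_addr //.
  rewrite powRM ?(ltW y_gt0) // ler_pM2r //.
  by apply: ler1_powR; rewrite ?ler1n // ltW.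
have le_rD : r%:R ^+ d.+1 <= rho * (4 * powR y gap_exp).
  apply: le_trans (_ : (rho * powR N%:R step_exp) ^+ d.+1 <= _).
    by rewrite ler_pXn2r // ?nnegrE ?mulr_ge0 ?powR_ge0 // ltW.
  rewrite exprMn powR_step_exp ler_pM ?exprn_ge0 ?powR_ge0 ?(ltW rho_gt0) //.
  by rewrite ler_iXnr // ltW.
rewrite ltr_pdivrMr //.
apply: le_lt_trans (_ : falling * (rho * (4 * powR y gap_exp)) < _).
  by rewrite ler_pM2l.
by move: (powR y _) ye_gt0 crho => z; nra.
Qed.

(** The index of the interval of length 2^-(d + 2) containing the fractional part
    of n^alpha; the top colour, never taken, gives the type the successor form
    that [inord] requires. *)
Definition frac_colour (n : nat) : 'I_(2 ^ d.+2).+1 :=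
  let x : R := powR n%:R alpha in
  inord (Num.truncn (2 ^+ d.+2 * (x - (Num.floor x)%:~R))).

Lemma frac_colour_near n (c := (frac_colour n)%:R / 2 ^+ d.+2 : R) :
  c <= powR n%:R alpha - (floor_pow alpha n)%:~R <= c + (2 ^+ d.+2)^-1.
Proof.
have M_gt0 : 0 < 2 ^+ d.+2 :> R by rewrite exprn_gt0.
have -> : c + (2 ^+ d.+2)^-1 = (frac_colour n).+1%:R / 2 ^+ d.+2.
  by rewrite -[(frac_colour n).+1%:R]natr1 mulrDl mul1r.
rewrite ler_pdivrMr // ler_pdivlMr //.
rewrite /frac_colour -/(floor_pow alpha n).
set f := _ - _; have /andP[f_ge0 f_lt1] : 0 <= f < 1.
  have /andP[] := floor_itv (powR n%:R alpha); rewrite intrD => fl1 fl2.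
  by apply/andP; split; rewrite /f /floor_pow; lra.
have Mf_ge0 : 0 <= 2 ^+ d.+2 * f by rewrite mulr_ge0 // ltW.
rewrite inordK; last first.
  rewrite ltnS truncn_le_nat -[(2 ^ d.+2)%N.+1%:R]natr1 natrX.
  by rewrite ltr_wpDr // gtr_pMr.
have /andP[? ?] := truncn_itv Mf_ge0; rewrite [f * _]mulrC.
by apply/andP; split=> //; apply: ltW.
Qed.

Lemma mono_diff_floor_eq0 N n r k j (rho : R) c :
  (0 < n)%N -> (0 < r)%N -> (N <= 4 * n)%N ->
  0 < rho <= 1 -> 8 * falling * rho < 1 -> r%:R <= rho * powR N%:R step_exp ->
  (forall i, (i < k)%N -> frac_colour (n + i * r) = c) -> (j + d.+1 < k)%N ->
  iter d.+1 (@fdiff int) (fun j => floor_pow alpha (n + j * r)) j = 0.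
Proof.
move=> n_gt0 r_gt0 leN rho1 crho le_r mono ltjk.
apply: (@diff_floor_eq0 R d _ j (c%:R / 2 ^+ d.+2)); first exact: diff_small le_r.
by move=> i lei; rewrite -(mono i) ?frac_colour_near //; lia.
Qed.

End Power.

(** * Counting *)

(** Comparing cardinals through a relation lets the two counts below pair a set
    with parameters describing it without naming a function that picks them. *)
Lemma card_le_rel (T1 T2 : finType) (A1 : {set T1}) (A2 : {set T2})
    (r : T1 -> T2 -> Prop) :
  (forall x, x \in A1 -> exists2 y, y \in A2 & r x y) ->
  (forall x1 x2 y, r x1 y -> r x2 y -> x1 = x2) ->
  (#|A1| <= #|A2|)%N.
Proof.
move=> ex_r inj_r.
have /fin_all_exists2[f fA fr] (x : {x | x \in A1}) :
    exists2 y, y \in A2 & r (val x) y.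
  exact: ex_r (valP x).
have f_inj : injective f.
  move=> x1 x2 E; apply/val_inj/(inj_r _ _ (f x1)); first exact: fr.
  by rewrite E; apply: fr.
have <- : #|{: {x | x \in A1}}| = #|A1| by rewrite card_sig; apply: eq_card.
rewrite -(card_codom f_inj); apply/subset_leq_card/subsetP => _ /codomP[x ->].
exact: fA.
Qed.

Section Count.
Variables (R : realType) (d : nat) (alpha : R) (k : nat).
Hypotheses (hd : (1 <= d)%N) (halpha : d%:R < alpha < d.+1%:R).
Hypothesis hk : (d + 2 <= k)%N.

Lemma powR_step_ge1 N : (0 < N)%N -> 1 <= powR N%:R (step_exp d alpha).
Proof.
have /andP[/ltW g_ge0 _] := step_exp_bounds halpha => N_gt0.
by rewrite (le_trans _ (ler_powR _ g_ge0)) ?powRr0 ?ler1n.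
Qed.

(** A progression is determined by its first term, at most N, and its step, of
    size at most a constant times N^step_exp. *)
Lemma card_AP_to_P_le N : (0 < N)%N ->
  #|AP_to_P alpha k d N|%:R <=
    2 * (2 + 2 ^+ d.+1 / falling d alpha) * (N%:R * powR N%:R (step_exp d alpha)).
Proof.
move=> N_gt0; set K := 2 ^+ d.+1 / falling d alpha; set g := powR _ _.
have K_ge0 : 0 <= K by rewrite divr_ge0 ?exprn_ge0 // ltW // falling_gt0.
have g_ge1 : 1 <= g by apply: powR_step_ge1.
have N_ge1 : 1 <= N%:R :> R by rewrite ler1n.
have Kg_ge0 : 0 <= (1 + K) * g by nra.
pose M := Num.truncn ((1 + K) * g).
have /andP[le_M _] := truncn_itv Kg_ge0.
have le_card : (#|AP_to_P alpha k d N| <= N.+1 * M.+1)%N.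
  pose T := ('I_N.+1 * 'I_M.+1)%type.
  have <- : #|[set: T]| = (N.+1 * M.+1)%N by rewrite cardsT card_prod !card_ord.
  apply: (card_le_rel (r := fun P (p : T) => elements P = APseq p.1 p.2 k))
    => [P|P Q p EP EQ].
    case/AP_to_P_elim=> [|n [r [n_gt0 r_gt0 leN EP fl0]]]; first by lia.
    have le_rM : (r <= M)%N.
      rewrite truncn_ge_nat //.
      apply: step_le n_gt0 r_gt0 _ (fl0 0%N _) => //; last by lia.
      by apply: leq_trans leN; rewrite leq_add2l leq_mul2r; lia.
    exists (inord n, inord r); rewrite ?inE //= !inordK ?ltnS //.
    by apply: leq_trans leN; rewrite leq_addr.
  by apply: elements_inj; rewrite EP EQ.
apply: le_trans (_ : (N.+1 * M.+1)%:R <= _); first by rewrite ler_nat.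
rewrite natrM -[N.+1%:R]natr1 -[M.+1%:R]natr1.
apply: le_trans (_ : (2 * N%:R) * ((2 + K) * g) <= _); last first.
  by rewrite !mulrA [2 * _ * N%:R]mulrAC.
by apply: ler_pM; rewrite ?addr_ge0 //; [lra | rewrite /M in le_M *; nra].
Qed.

(** Each of the m q progressions of W terms with first term s in (m, 2m] and
    step u in [1, q] contains a monochromatic progression of k terms, with first
    term s + a u and step t u where a, t < W.  That one determines s and u once
    a and t are known, so it is reached at most W^2 times. *)
Lemma card_AP_to_P_ge W :
  (forall c : nat -> 'I_(2 ^ d.+2).+1, mono_AP c k.-1 W) ->
  forall (rho : R) N m q, 0 < rho <= 2^-1 -> 8 * falling d alpha * rho < 1 ->
  (4 * m <= N <= 4 * m.+1)%N ->
  (W * q)%:R <= rho * powR N%:R (step_exp d alpha) ->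
  (m * q <= #|AP_to_P alpha k d N| * (W * W))%N.
Proof.
move=> vdW rho N m Q /andP[rho_gt0 rho_le] crho /andP[le_mN le_Nm] le_Q.
have /andP[_ /ltW g_le1] := step_exp_bounds halpha.
have a_ge1 : 1 <= alpha.
  by case/andP: halpha => /ltW + _; apply: le_trans; rewrite ler1n.
have rho_le1 : 0 < rho <= 1 by apply/andP; split; lra.
have [m0|m_gt0] := posnP m; first by rewrite m0.
have le_WQ : (2 * (W * Q) <= N)%N.
  have N_ge1 : 1 <= N%:R :> R by rewrite ler1n; lia.
  rewrite -(ler_nat R) natrM.
  have := ler1_powR N_ge1 g_le1; have := powR_ge0 N%:R (step_exp d alpha).
  by move: le_Q; move: (powR _ _) (_%:R) => x y; nra.
pose T1 := ('I_m * 'I_Q)%type; pose T2 := ('I_W * 'I_W)%type.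
have <- : #|[set: T1]| = (m * Q)%N by rewrite cardsT card_prod !card_ord.
have <- : #|[set: T2]| = (W * W)%N by rewrite cardsT card_prod !card_ord.
rewrite -cardsX.
pose rel (p : T1) (x : {set 'I_N.+1} * T2) :=
  (0 < x.2.2)%N /\ elements x.1 =
    APseq (m.+1 + p.1 + x.2.1 * p.2.+1) (x.2.2 * p.2.+1) k.
apply: (card_le_rel (r := rel)) => [[i j] _|[i1 j1] [i2 j2] [P [a t]]]; last first.
  rewrite /rel /= => -[t_gt0 EP] [_]; rewrite EP => /APseq_inj[|E1 E2].
    by lia.
  have Ej : j1 = j2 by apply/ord_inj/eqP; rewrite -eqSS -(eqn_pmul2l t_gt0) E2.
  by congr pair=> //; apply/ord_inj; move: E1; rewrite Ej; lia.
have [a [t [y [t_gt0 lt_W mono]]]] :=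
  vdW (fun x => frac_colour d alpha (m.+1 + i + x * j.+1)).
have lti := ltn_ord i; have ltj := ltn_ord j.
have lt_aW : (a < W)%N by apply: leq_ltn_trans lt_W; rewrite leq_addr.
have lt_tW : (t < W)%N.
  by apply: leq_ltn_trans lt_W; rewrite mulSn addnCA leq_addr.
pose n := (m.+1 + i + a * j.+1)%N; pose r := (t * j.+1)%N.
have n_gt0 : (0 < n)%N by [].
have r_gt0 : (0 < r)%N by rewrite muln_gt0 t_gt0.
have le_n : (N <= 4 * n)%N by rewrite /n; lia.
have le_nr : (n + k.-1 * r <= N)%N.
  have -> : (n + k.-1 * r = m.+1 + i + (a + k.-1 * t) * j.+1)%N.
    by rewrite /n /r; ring.
  have : ((a + k.-1 * t) * j.+1 <= W * Q)%N by apply: leq_mul => //; lia.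
  lia.
have le_r : r%:R <= rho * powR N%:R (step_exp d alpha).
  by apply: le_trans le_Q; rewrite ler_nat leq_mul // ltnW.
have [P EP] := APset_exists r_gt0 le_nr.
exists (P, (Ordinal lt_aW, Ordinal lt_tW)) => //.
rewrite in_setX in_setT andbT; apply: AP_to_P_intro EP _ => // l ltl.
apply: (mono_diff_floor_eq0 halpha n_gt0 r_gt0 le_n rho_le1 crho le_r (c := y))
  ltl => l' ltl'.
by rewrite -(mono l') ?/n ?/r; [congr frac_colour; ring | lia].
Qed.

End Count.

Lemma quarter_bounds N : (4 <= N)%N ->
  (4 * (N %/ 4) <= N <= 4 * (N %/ 4).+1)%N /\ (N <= 8 * (N %/ 4))%N.
Proof. by split; lia. Qed.

Theorem theorem1p3 (R : realType) (d : nat) (hd : (1 <= d)%N)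
    (alpha : R) (halpha : d%:R < alpha < d.+1%:R)
    (k : nat) (hk : (d + 2 <= k)%N) :
  exists A B : R, exists N0 : nat,
    [/\ 0 < A, 0 < B, (1 <= N0)%N &
      forall N : nat, (N0 <= N)%N ->
        A * powR N%:R (2 - alpha / d.+1%:R)
          <= #|AP_to_P alpha k d N|%:R
          <= B * powR N%:R (2 - alpha / d.+1%:R)].
Proof.
have c_gt0 := falling_gt0 halpha; have /andP[g_gt0 g_lt1] := step_exp_bounds halpha.
have [W vdW] := @van_der_Waerden k.-1 'I_(2 ^ d.+2).+1.
have W_gt0 : (0 < W)%N by have [a [t [y [_ + _]]]] := vdW (fun=> ord0); case: (W).
have W_gt0' : 0 < W%:R :> R by rewrite ltr0n.
(* this choice gives both rho <= 1/2, which keeps the progressions below N,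
   and 8 * falling * rho < 1, which makes the differences small *)
pose rho : R := (2 + 16 * falling d alpha)^-1.
have den_gt0 : 0 < 2 + 16 * falling d alpha by lra.
have rho_gt0 : 0 < rho by rewrite invr_gt0.
have rho_le : rho <= 2^-1 by rewrite lef_pV2 ?posrE //; lra.
have crho : 8 * falling d alpha * rho < 1 by rewrite ltr_pdivrMr //; lra.
pose c0 := rho / W%:R.
have c0_gt0 : 0 < c0 by rewrite divr_gt0.
have B_gt0 : 0 < 2 * (2 + 2 ^+ d.+1 / falling d alpha).
  by rewrite mulr_gt0 // addr_gt0 // divr_gt0 // exprn_gt0.
exists (c0 / (16 * (W * W)%:R)), (2 * (2 + 2 ^+ d.+1 / falling d alpha)).
(* the threshold ensures c0 * N^step_exp >= 1, so that some step is available *)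
exists (4 + Num.truncn (powR c0^-1 (step_exp d alpha)^-1)).+1.
split=> //.
  by rewrite divr_gt0 // mulr_gt0 // ltr0n muln_gt0 W_gt0.
move=> N leN; have N_gt0 : (0 < N)%N by apply: leq_trans leN.
have -> : 2 - alpha / d.+1%:R = 1 + step_exp d alpha by rewrite addrA.
have N_neq0 : N%:R != 0 :> R by rewrite pnatr_eq0 -lt0n.
rewrite powRD ?N_neq0 ?implybT // powRr1 ?ler0n //.
apply/andP; split; last exact: card_AP_to_P_le.
set g := powR _ _.
have c0g_ge1 : 1 <= c0 * g.
  rewrite -ler_pdivrMl // mulr1.
  have -> : c0^-1 = powR (powR c0^-1 (step_exp d alpha)^-1) (step_exp d alpha).
    by rewrite -powRrM mulVf ?gt_eqF // powRr1 // invr_ge0 ltW.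
  apply: ge0_ler_powR; rewrite ?nnegrE ?powR_ge0 ?ler0n ?(ltW g_gt0) //.
  have /truncn_itv/andP[_ /ltW/le_trans->] // := powR_ge0 c0^-1 (step_exp d alpha)^-1.
  by rewrite ler_nat (leq_trans _ leN) // ltnS leq_addl.
have {leN} N_ge4 : (4 <= N)%N.
  by apply: leq_trans leN; rewrite ltnW // ltnS leq_addr.
have [quarter le_N] := quarter_bounds N_ge4.
have c0g_ge0 : 0 <= c0 * g by lra.
have /andP[le_Q lt_Q] := truncn_itv c0g_ge0.
set Q := Num.truncn _ in le_Q lt_Q.
have le_card : ((N %/ 4) * Q <= #|AP_to_P alpha k d N| * (W * W))%N.
  apply: (card_AP_to_P_ge hd halpha hk vdW (rho := rho)) => //.
  - by rewrite rho_gt0.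
  - by rewrite natrM mulrC -ler_pdivlMr // mulrAC.
have {}le_card :
    (N %/ 4)%:R * Q%:R <= #|AP_to_P alpha k d N|%:R * (W * W)%:R :> R.
  by rewrite -!natrM ler_nat.
have WW_gt0 : 0 < (W * W)%:R :> R by rewrite ltr0n muln_gt0 W_gt0.
have {}le_N : N%:R <= 8 * (N %/ 4)%:R :> R by rewrite -natrM ler_nat.
have Q_ge1 : 1 <= Q%:R :> R by rewrite ler1n truncn_gt0.
have {lt_Q} le_g : c0 * g <= 2 * Q%:R.
  by move: lt_Q; rewrite -[Q.+1%:R]natr1; lra.
rewrite mulrAC ler_pdivrMr ?mulr_gt0 //.
apply: le_trans (_ : 16 * ((N %/ 4)%:R * Q%:R) <= _).
  have -> : c0 * (N%:R * g) = N%:R * (c0 * g) by ring.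
  have -> : 16 * ((N %/ 4)%:R * Q%:R) = 8 * (N %/ 4)%:R * (2 * Q%:R) :> R by ring.
  by apply: ler_pM le_N le_g.
by rewrite [leRHS]mulrCA ler_pM2l.
Qed.
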